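(* Let $r\ge 1$, let $S_\ell$, $\ell=1,\dots,r$, be a selection of $2\times 2$ shear matrices, i.e. matrices of the form $\begin{pmatrix}1&k\\0&1\end{pmatrix}$ with $k\in\mathbb{Z}$, let $A_4=\begin{pmatrix}4&0\\0&2\end{pmatrix}$, and let $a_\ell:\mathbb{Z}^2\to\mathbb{R}$, $\ell=1,\dots,r$, be finitely supported masks. Then the following conditions are equivalent. (i) For all $v\in l(\mathbb{Z}^2)$, $$\sum_{\ell=1}^r \mathrm{S}_{a_\ell,S_\ell A_4}\,\mathrm{T}_{a_\ell,S_\ell A_4}\,v=v .$$ (ii) For every $\omega\in\Omega:=\bigcup_{\ell=1}^r\Omega_{S_\ell A_4}$, where $\Omega_{S_\ell A_4}:=[(S_\ell^T)^{-1}(\tfrac14\mathbb{Z}\times\tfrac12\mathbb{Z})]\cap[0,1)^2$, and every $\xi\in\mathbb{R}^2$, $$\sum_{\ell\in\{1\le n\le r\,:\,\omega\in\Omega_{S_nA_4}\}}\widehat{a_\ell}(\xi)\,\overline{\widehat{a_\ell}(\xi+2\pi\omega)}=\delta(\omega).$$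
   Context: $l(\mathbb{Z}^2)$ is the space of all complex-valued sequences on $\mathbb{Z}^2$. For an invertible integer $2\times2$ matrix $M$ and a finitely supported sequence (mask) $a:\mathbb{Z}^2\to\mathbb{R}$, the subdivision operator $\mathrm{S}_{a,M}$ and the transition operator $\mathrm{T}_{a,M}$ on $l(\mathbb{Z}^2)$ are $$[\mathrm{S}_{a,M}v](n)=|\det M|\sum_{k\in\mathbb{Z}^2}v(k)\,a(n-Mk),\qquad [\mathrm{T}_{a,M}v](n)=\sum_{k\in\mathbb{Z}^2}v(k)\,\overline{a(k-Mn)} .$$ Further, $\hat a(\xi)=\sum_{k\in\mathbb{Z}^2}a(k)e^{-ik\cdot\xi}$, and $\delta(0)=1$, $\delta(\omega)=0$ for $\omega\ne0$. *)

(* Defs.v *)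
From HB Require Import structures.
From mathcomp Require Import all_boot all_order all_algebra.
From mathcomp Require Import complex.
From mathcomp Require Import all_classical all_reals all_analysis.

Set Implicit Arguments.
Unset Strict Implicit.
Unset Printing Implicit Defensive.

Import Order.TTheory GRing.Theory Num.Theory.

Local Open Scope classical_set_scope.
Local Open Scope complex_scope.
Local Open Scope ring_scope.

(* Points of Z^2 and R^2 are column vectors.  The sums \sum_(k \in A) below
   are sums over the support of the summand, and are 0 by convention when that
   support is infinite; all those below have finite support when the mask is
   finitely supported and \det M != 0. *)

Definition mx2 (a b c d : int) : 'M[int]_2 :=
  \matrix_(i, j) if i == 0 then (if j == 0 then a else b)
                 else (if j == 0 then c else d).

Definition shear (S : 'M[int]_2) : Prop := exists k : int, S = mx2 1 k 0 1.

Definition A4 : 'M[int]_2 := mx2 4 0 0 2.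

Section Framelets.
Variable R : realType.

Definition finitely_supported (a : 'cV[int]_2 -> R) : Prop :=
  finite_set [set k | a k != 0].

Definition subdivision (a : 'cV[int]_2 -> R) (M : 'M[int]_2)
    (v : 'cV[int]_2 -> R[i]) (n : 'cV[int]_2) : R[i] :=
  `|\det M|%:~R * \sum_(k \in [set: 'cV[int]_2]) v k * (a (n - M *m k))%:C.

Definition transition (a : 'cV[int]_2 -> R) (M : 'M[int]_2)
    (v : 'cV[int]_2 -> R[i]) (n : 'cV[int]_2) : R[i] :=
  \sum_(k \in [set: 'cV[int]_2]) v k * conjc (a (k - M *m n))%:C.

Definition dot (k : 'cV[int]_2) (xi : 'cV[R]_2) : R :=
  \sum_(i < 2) (k i 0)%:~R * xi i 0.

(* exp(i t) *)
Definition expi (t : R) : R[i] := cos t +i* sin t.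

Definition mask_hat (a : 'cV[int]_2 -> R) (xi : 'cV[R]_2) : R[i] :=
  \sum_(k \in [set: 'cV[int]_2]) (a k)%:C * expi (- dot k xi).

(* (1/4)Z x (1/2)Z *)
Definition quarter_half_lattice : set 'cV[R]_2 :=
  [set x | (exists p : int, x 0 0 = p%:~R / 4) /\
           (exists q : int, x 1 0 = q%:~R / 2)].

Definition unit_square : set 'cV[R]_2 :=
  [set x | forall i, 0 <= x i 0 < 1].

(* Omega S is the set denoted Omega_{S A_4}. *)
Definition Omega (S : 'M[int]_2) : set 'cV[R]_2 :=
  [set invmx (map_mx intr S)^T *m x | x in quarter_half_lattice]
    `&` unit_square.

Definition delta (w : 'cV[R]_2) : R[i] := if w == 0 then 1 else 0.

End Framelets.

(* Main.v *)
(* Put M_l = S_l A_4.  Since |det M_l| = 8 is the number of points of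
   Omega_(M_l), the dual group of Z^2 / M_l Z^2, the indicator of M_l Z^2 is the
   mean of the characters z |-> e^(2 pi i z.w) over w in Omega_(M_l).  Inserting
   it into the left-hand side of (i) gives
     sum_(w in Omega) e^(-2 pi i n.w) sum_(p, q) c_w(p, q) v(n + p - q),
     c_w(p, q) = e^(2 pi i q.w) sum_(l : w in Omega_(M_l)) a_l(p) a_l(q),
   while the left-hand side of (ii) is
     G_w(xi) = sum_(p, q) c_w(p, q) e^(-i (p - q).xi).
   For (i) => (ii), take v(m) = e^(-i m.xi): then sum_w e^(-2 pi i n.w) G_w(xi) = 1
   for all n, so G_w(xi) = delta(w) by Dedekind's independence of the characters
   n |-> e^(-2 pi i n.w).  For (ii) => (i), independence of the characters
   xi |-> e^(-i d.xi) identifies the coefficients of G_w = delta(w), which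
   allows e^(-i d.xi) to be replaced by v(n + d). *)

Require Import Defs.
From mathcomp Require Import all_boot all_order all_algebra.
From mathcomp Require Import complex.
From mathcomp Require Import all_classical all_reals all_analysis.
From mathcomp Require Import ring lra zify.

Set Implicit Arguments.
Unset Strict Implicit.
Unset Printing Implicit Defensive.

Import Order.TTheory GRing.Theory Num.Theory.

Local Open Scope classical_set_scope.
Local Open Scope complex_scope.
Local Open Scope ring_scope.

(** * Independence of characters *)

(** Dedekind's argument, by induction on [s]: the relation at [x + y] minus [chi i y] times the
    relation at [x] eliminates the head [i]. Induction gives [c j * (chi j y - chi i y) = 0] for all
    [y], so a nonzero [c j] would force [chi j = chi i]. *)
Lemma characters_independent (G : zmodType) (K : fieldType) (I : eqType)
    (chi : I -> G -> K) (s : seq I) (c : I -> K) :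
  (forall i x y, chi i (x + y) = chi i x * chi i y) ->
  (forall i, chi i 0 = 1) ->
  uniq s -> {in s &, forall i j, chi i =1 chi j -> i = j} ->
  (forall x, \sum_(i <- s) c i * chi i x = 0) -> {in s, forall i, c i = 0}.
Proof.
move=> chiD chi0; elim: s c => [//|i s IH] c /= /andP[iNs us] inj sum0.
have cs0 : {in s, forall j, c j = 0}.
  move=> j js; apply: contraNeq iNs => cj0.
  suff /inj -> // : chi i =1 chi j by rewrite ?mem_head // inE js orbT.
  move=> y; apply/esym/eqP; rewrite -subr_eq0 -(mulrI_eq0 _ (mulfI cj0)).
  apply/eqP.
  apply: (IH (fun j => c j * (chi j y - chi i y))) => // [k l ks ls|x].
    by apply: inj; rewrite inE ?ks ?ls orbT.
  have split_term k : c k * (chi k y - chi i y) * chi k x =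
      c k * chi k (x + y) - chi i y * (c k * chi k x) by rewrite chiD; ring.
  rewrite (eq_bigr _ (fun k _ => split_term k)) sumrB -mulr_sumr.
  have := sum0 (x + y); have := sum0 x; rewrite !big_cons chiD.
  move=> /eqP; rewrite addr_eq0 => /eqP e1 /eqP.
  rewrite mulrA e1 mulNr addrC subr_eq0 mulrC => /eqP ->.
  exact: subrr.
move=> j; rewrite inE => /predU1P[->|/cs0//].
have := sum0 0; rewrite big_cons chi0 mulr1 big_seq big1 ?addr0 // => k /cs0 ->.
by rewrite mul0r.
Qed.

(** Different [j] may share the same [d j]; collecting them leaves distinct characters, whose total
    coefficients vanish by independence. Only these totals matter for an arbitrary [f]. *)
Lemma character_sum_eq0 (G : zmodType) (K : fieldType) (I : eqType)
    (chi : I -> G -> K) (J : eqType) (s : seq J) (d : J -> I) (c : J -> K) :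
  (forall i x y, chi i (x + y) = chi i x * chi i y) ->
  (forall i, chi i 0 = 1) -> (forall i j, chi i =1 chi j -> i = j) ->
  (forall x, \sum_(j <- s) c j * chi (d j) x = 0) ->
  forall f : I -> K, \sum_(j <- s) c j * f (d j) = 0.
Proof.
move=> chiD chi0 inj sum0 f.
have regroup g : \sum_(j <- s) c j * g (d j) =
    \sum_(i <- undup (map d s)) (\sum_(j <- s | d j == i) c j) * g i.
  under [RHS]eq_bigr do rewrite mulr_suml big_mkcond.
  rewrite exchange_big /=. apply: eq_big_seq => j js /=.
  rewrite (bigD1_seq (d j)) ?undup_uniq ?mem_undup ?map_f //= eqxx big1 ?addr0 //.
  by move=> i; rewrite eq_sym => /negPf ->.
rewrite regroup big_seq big1 // => i iD.
suff -> : \sum_(j <- s | d j == i) c j = 0 by rewrite mul0r.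
apply: (characters_independent (c := fun i => \sum_(j <- s | d j == i) c j)
  chiD chi0 (undup_uniq (map d s))) => // [k l _ _|x]; first exact: inj.
by rewrite -(regroup (chi ^~ x)).
Qed.

(** * The exponential on the unit circle *)

Section Expi.
Variable R : realType.
Implicit Types t u : R.

Lemma expiD t u : expi (t + u) = expi t * expi u.
Proof.
apply/eqP; rewrite eq_complex /= cosD sinD addrC.
by rewrite [X in _ && (X == _)]addrC !eqxx.
Qed.

Lemma expi0 : expi 0 = 1 :> R[i].
Proof. by rewrite /expi cos0 sin0. Qed.

Lemma conjc_expi t : conjc (expi t) = expi (- t).
Proof. by rewrite /expi cosN sinN. Qed.

Lemma expiMn t n : expi (t *+ n) = expi t ^+ n.
Proof. by elim: n => [|n IH]; rewrite ?expi0 // mulrS exprS expiD IH. Qed.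

Lemma expi2pi_int (m : int) : expi (2 * pi * m%:~R) = 1 :> R[i].
Proof.
have h n : expi (2 * pi * n%:R) = 1 :> R[i].
  rewrite mulr_natr expiMn /expi mulr_natl cos2pi sin2pi.
  exact: expr1n.
case: m => n; first exact: h.
by rewrite NegzE mulrN -conjc_expi h conjc1.
Qed.

(** Otherwise [sin (t / 2)] is positive, and cos t = 1 - 2 sin^2(t/2) is less than 1. *)
Lemma expi_eq1 t : 0 <= t < 2 * pi -> expi t = 1 -> t = 0.
Proof.
move=> /andP[t0 t2] [c1 _]; apply/eqP; apply: contraTT (ltr01 : 0 < 1 :> R) => tn0.
have tpos : 0 < t by rewrite lt_def tn0.
have s0 : 0 < sin (t / 2) by apply: sin_gt0_pi; apply/andP; split; lra.
have := c1; rewrite {1}(_ : t = (t / 2) + t / 2); last by lra.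
by rewrite cosD; have := cos2Dsin2 (t / 2); nra.
Qed.

End Expi.

(** * Sums of roots of unity, and the characters of Z^2 and R^2 *)

Section Torus.
Variable R : realType.
Implicit Types t u : R.

Lemma expiNl t : expi (- t) * expi t = 1.
Proof. by rewrite -expiD addNr expi0. Qed.

Lemma expi_inj t u :
  0 <= t < 2 * pi -> 0 <= u < 2 * pi -> expi t = expi u -> t = u.
Proof.
wlog tu : t u / t <= u => [hw ht hu e|].
  by case/orP: (le_total t u) => tu; [|symmetry]; apply: hw.
move=> /andP[t0 t2] /andP[u0 u2] e; apply/esym/eqP; rewrite -subr_eq0; apply/eqP.
apply: expi_eq1; first by apply/andP; split; lra.
by rewrite addrC expiD -e expiNl.
Qed.

Lemma expi_scaling_eq1 (c : R) : (forall t, expi (c * t) = 1) -> c = 0.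
Proof.
move=> h; apply/eqP; apply: contraT => c0.
(* At [t = pi / c] the real part would be -1. *)
have := h (c^-1 * pi); rewrite mulrA mulfV // mul1r /expi cospi => -[].
by move=> ?; lra.
Qed.

(** A geometric sum: the terms are powers of z = e^(2 pi i u/N), with z^N = 1, and z = 1 exactly
    when N divides u. *)
Lemma sum_expi_root (N : nat) (u : int) : (0 < N)%N ->
  \sum_(p < N) expi (2 * pi * (p%:R * (u%:~R / N%:R))) =
    if (N %| u)%Z then N%:R else 0 :> R[i].
Proof.
move=> N0; set z : R[i] := expi (2 * pi * (u%:~R / N%:R)).
have NR0 : N%:R != 0 :> R by rewrite pnatr_eq0 -lt0n.
rewrite (eq_bigr (fun p : 'I_N => z ^+ p)) => [|p _]; last first.
  by rewrite -expiMn -[in RHS]mulr_natr; congr expi; ring.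
have z1 : (z == 1) = (N %| u)%Z.
  apply/eqP/idP => [|/dvdzP[q uE]]; last first.
    rewrite /z uE (_ : _ / _ = q%:~R) ?expi2pi_int //.
    by rewrite intrM -pmulrn mulfK.
  have r0 : 0 <= (u %% N)%Z%:~R :> R by rewrite ler0z modz_ge0 // -lt0n.
  have rN : (u %% N)%Z%:~R < N%:R :> R by rewrite pmulrn ltr_int ltz_pmod.
  (* Only the remainder of [u] modulo [N] contributes, and it puts the angle in [0, 2 pi), where
     [expi_eq1] applies. *)
  rewrite /z (_ : u%:~R / N%:R = (u %/ N)%Z%:~R + (u %% N)%Z%:~R / N%:R); last first.
    by rewrite {1}(divz_eq u N) intrD intrM -pmulrn mulrDl mulfK.
  rewrite mulrDr expiD.
  rewrite expi2pi_int mul1r => /expi_eq1 h.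
  apply/dvdz_mod0P/eqP; rewrite -(@intr_eq0 R).
  have NRpos : 0 < N%:R :> R by rewrite ltr0n.
  have pi0 := pi_gt0 R.
  have /eqP : 2 * pi * ((u %% N)%Z%:~R / N%:R) = 0 :> R.
    apply: h; apply/andP; split.
      by rewrite mulr_ge0 ?divr_ge0 ?(ltW NRpos) // mulr_ge0 ?(ltW pi0).
    by rewrite -[ltRHS]mulr1 ltr_pM2l ?mulr_gt0 // ltr_pdivrMr // mul1r.
  by rewrite !mulf_eq0 invr_eq0 (negPf NR0) (gt_eqF pi0) pnatr_eq0 !orbF.
rewrite -z1; case: ifPn => [/eqP ->|nz1].
  by under eq_bigr do rewrite expr1n; rewrite sumr_const card_ord.
have zN : z ^+ N = 1.
  rewrite -expiMn -[_ *+ N]mulr_natr (_ : _ * _ = 2 * pi * u%:~R) ?expi2pi_int //.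
  by rewrite -!mulrA mulVf ?mulr1.
have /eqP := subrX1 z N; rewrite zN subrr eq_sym mulf_eq0 subr_eq0 (negPf nz1).
by move=> /eqP.
Qed.

Lemma dotDl (k l : 'cV[int]_2) (x : 'cV[R]_2) : dot (k + l) x = dot k x + dot l x.
Proof. by rewrite /dot -big_split; apply: eq_bigr => i _; rewrite !mxE intrD mulrDl. Qed.

Lemma dotDr (k : 'cV[int]_2) (x y : 'cV[R]_2) : dot k (x + y) = dot k x + dot k y.
Proof. by rewrite /dot -big_split; apply: eq_bigr => i _; rewrite !mxE mulrDr. Qed.

Lemma dotZr (k : 'cV[int]_2) c (x : 'cV[R]_2) : dot k (c *: x) = c * dot k x.
Proof. by rewrite /dot mulr_sumr; apply: eq_bigr => i _; rewrite !mxE mulrCA. Qed.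

Lemma dotNl (k : 'cV[int]_2) (x : 'cV[R]_2) : dot (- k) x = - dot k x.
Proof. by rewrite /dot -sumrN; apply: eq_bigr => i _; rewrite !mxE rmorphN mulNr. Qed.

Lemma dot0l (x : 'cV[R]_2) : dot 0 x = 0.
Proof. by rewrite /dot big1 // => i _; rewrite !mxE mul0r. Qed.

Lemma dot0r (k : 'cV[int]_2) : dot k (0 : 'cV[R]_2) = 0.
Proof. by rewrite /dot big1 // => i _; rewrite !mxE mulr0. Qed.

Lemma dot_deltal i (x : 'cV[R]_2) : dot (delta_mx i 0) x = x i 0.
Proof.
rewrite /dot (bigD1 i) //= !mxE !eqxx mul1r big1 ?addr0 // => j /negPf ji.
by rewrite !mxE ji mul0r.
Qed.

Lemma dot_deltar (k : 'cV[int]_2) i : dot k (delta_mx i 0 : 'cV[R]_2) = (k i 0)%:~R.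
Proof.
rewrite /dot (bigD1 i) //= !mxE !eqxx mulr1 big1 ?addr0 // => j /negPf ji.
by rewrite !mxE ji mulr0.
Qed.

Definition freq_char (d : 'cV[int]_2) (xi : 'cV[R]_2) : R[i] := expi (- dot d xi).

(** Along the i-th axis the two characters differ by a factor of frequency d_i - e_i, which is
    constantly 1 only if d_i = e_i. *)
Lemma freq_char_inj d e : freq_char d =1 freq_char e -> d = e.
Proof.
move=> de; apply/matrixP => i j; rewrite ord1.
apply/eqP; rewrite -subr_eq0 -(@intr_eq0 R); apply/eqP.
apply: expi_scaling_eq1 => t; have /= := de (t *: delta_mx i 0).
rewrite /freq_char !dotZr !dot_deltar intrB mulrBl => h.
by rewrite [X in X - _]mulrC [X in _ - X]mulrC expiD -h [LHS]mulrC expiNl.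
Qed.

Definition point_char (w : 'cV[R]_2) (n : 'cV[int]_2) : R[i] :=
  expi (- (2 * pi * dot n w)).

(** As [point_char w] depends only on w modulo Z^2, a fundamental domain is needed. The values at
    the negated unit vectors are e^(2 pi i w_i). *)
Lemma point_char_inj : {in @unit_square R &,
  forall w w', point_char w =1 point_char w' -> w = w'}.
Proof.
move=> w w' /set_mem hw /set_mem hw' ww'; apply/matrixP => i j; rewrite ord1.
have p0 : 0 < 2 * pi :> R by rewrite mulr_gt0 ?pi_gt0.
have range (x : R) : 0 <= x < 1 -> 0 <= 2 * pi * x < 2 * pi.
  move=> /andP[x0 x1]; rewrite mulr_ge0 ?(ltW p0) //=.
  by rewrite -[ltRHS]mulr1 ltr_pM2l.
apply: (mulfI (lt0r_neq0 p0)); apply: expi_inj.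
- exact/range/hw.
- exact/range/hw'.
- have /= := ww' (- delta_mx i 0).
  by rewrite /point_char !dotNl !mulrN !opprK !dot_deltal.
Qed.

End Torus.

(** * The eight points of Omega *)

Section Lattice.
Variable R : realType.

Lemma mulmx2E (K : pzRingType) (A : 'M[K]_2) (x : 'cV[K]_2) i :
  (A *m x) i 0 = A i 0 * x 0 0 + A i 1 * x 1 0.
Proof.
rewrite mxE !big_ord_recl big_ord0 addr0.
by congr (_ + A _ _ * x _ _); exact: val_inj.
Qed.

Lemma dotE (k : 'cV[int]_2) (x : 'cV[R]_2) :
  dot k x = (k 0 0)%:~R * x 0 0 + (k 1 0)%:~R * x 1 0.
Proof.
rewrite /dot !big_ord_recl big_ord0 addr0.
by congr (_ + (k _ _)%:~R * x _ _); exact: val_inj.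
Qed.

Lemma cV2P (T : Type) (x y : 'cV[T]_2) : x 0 0 = y 0 0 -> x 1 0 = y 1 0 -> x = y.
Proof.
move=> e0 e1; apply/matrixP => i j; rewrite ord1.
have [->//|->//] : i = 0 \/ i = 1.
by case: i => [[|[|//]] ?]; [left|right]; exact: val_inj.
Qed.

(** Here S A_4 y = (4 y_0 + 2 k y_1, 2 y_1); undoing the shear leaves 4Z x 2Z. *)
Lemma shear_A4_rangeP (k : int) (z : 'cV[int]_2) :
  range (fun y => mx2 1 k 0 1 *m A4 *m y) z <->
  (4 %| (z 0 0 - k * z 1 0)%R)%Z && (2 %| z 1%R 0%R)%Z.
Proof.
split=> [[y _ <-]|/andP[/dvdzP[s es] /dvdzP[t et]]].
  rewrite -mulmxA !mulmx2E !mxE /= !mul0r !add0r !addr0 !mul1r.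
  by apply/andP; split; apply/dvdzP; [exists (y 0 0)|exists (y 1 0)]; ring.
exists (\col_i (if i == 0 then s else t)) => //.
apply: cV2P; rewrite -mulmxA !mulmx2E !mxE /=; lia.
Qed.

Lemma OmegaP (k : int) (w : 'cV[R]_2) :
  Omega (mx2 1 k 0 1) w <->
  [/\ unit_square w, exists p : int, w 0 0 = p%:~R / 4
    & exists q : int, k%:~R * w 0 0 + w 1 0 = q%:~R / 2].
Proof.
set T := (map_mx intr (mx2 1 k 0 1))^T : 'M[R]_2.
have T0 (x : 'cV[R]_2) : (T *m x) 0 0 = x 0 0.
  by rewrite mulmx2E !mxE /= mul1r mul0r addr0.
have T1 (x : 'cV[R]_2) : (T *m x) 1 0 = k%:~R * x 0 0 + x 1 0.
  by rewrite mulmx2E !mxE /= mul1r.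
have Tu : T \in unitmx.
  rewrite unitmxE det_tr (expand_det_row _ 0) !big_ord_recl big_ord0 /cofactor.
  by rewrite !det_mx11 !mxE /= mulr0 mulr0 !addr0 mul1r expr0 mul1r unitr1.
split=> [[[x [[p xp] [q xq]] <-] sq]|[sq [p wp] [q wq]]].
  split=> //; [exists p|exists q]; first by rewrite -T0 mulKVmx.
  by rewrite -T1 mulKVmx.
split=> //; exists (T *m w); last by rewrite mulKmx.
by split; [exists p; rewrite T0|exists q; rewrite T1].
Qed.

Definition frac (x : R) : R := x - (Num.floor x)%:~R.

(** The point (S^T)^(-1) (p/4, q/2) reduced modulo Z^2; p/4 already lies in [0, 1). *)
Definition dual_point (k : int) (pq : 'I_4 * 'I_2) : 'cV[R]_2 :=
  \col_i (if i == 0 then pq.1%:R / 4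
          else frac (pq.2%:R / 2 - k%:~R * (pq.1%:R / 4))).

Lemma frac_itv x : 0 <= frac x < 1.
Proof. by rewrite /frac subr_ge0 ltrBlDl -intrD1 floor_itv. Qed.

Lemma dual_point_inj k : injective (dual_point k).
Proof.
move=> [p q] [p' q'] /matrixP e.
have /mulIf inv4 : 4^-1 != 0 :> R by rewrite invr_eq0 pnatr_eq0.
have pp : p = p'.
  by have := e 0 0; rewrite !mxE /= => /inv4/eqP; rewrite eqr_nat => /eqP/val_inj.
have := e 1 0; rewrite !mxE /= -{}pp /frac.
set f := Num.floor _; set f' := Num.floor _ => h.
have : (q%:Z = q'%:Z + 2 * (f - f')).
  apply/eqP; rewrite -(@eqr_int R) intrD intrM intrB -!pmulrn; apply/eqP; lra.
move=> qq; apply: congr2 => //; apply: val_inj => /=.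
by have := ltn_ord q; have := ltn_ord q'; lia.
Qed.

Lemma Omega_dual_point k : Omega (mx2 1 k 0 1) = range (dual_point k).
Proof.
apply/seteqP; split=> w.
  move=> /OmegaP[sq [p wp] [q wq]].
  have w0 := sq 0; have w1 := sq 1.
  have p0 : (0 <= p < 4)%R.
    by rewrite -(ler0z R) -(ltr_int R); apply/andP; lra.
  have p4 : (`|p| < 4)%N by lia.
  have q2 : (`|(q %% 2)%Z| < 2)%N by lia.
  have pE : `|p|%:R = p%:~R :> R by rewrite pmulrn; congr (_%:~R); lia.
  have rE : `|(q %% 2)%Z|%:R = (q %% 2)%Z%:~R :> R.
    by rewrite pmulrn; congr (_%:~R); lia.
  exists (Ordinal p4, Ordinal q2) => //; apply: cV2P; rewrite !mxE /=.
    by rewrite wp pE.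
  rewrite pE -wp.
  have qE : w 1 0 - (q %/ 2)%Z%:~R = `|(q %% 2)%Z|%:R / 2 - k%:~R * w 0 0.
    move: wq; rewrite {1}(divz_eq q 2) intrD intrM.
    by rewrite rE; lra.
  (* Since [w 1 0] lies in [0, 1), [qE] shows that the floor is [- (q %/ 2)]. *)
  rewrite -qE /frac (_ : Num.floor _ = - (q %/ 2)%Z) ?rmorphN /=; first by lra.
  by apply: floor_def; rewrite intrD rmorphN /=; apply/andP; lra.
move=> [[p q] _ <-]; apply/OmegaP; split.
- move=> i; rewrite mxE; case: ifP => _ /=; last exact: frac_itv.
  have : p%:R < 4 :> R by rewrite (ltr_nat R p 4).
  have : 0 <= p%:R :> R by [].
  by move=> *; apply/andP; lra.
- by exists p; rewrite mxE.
- exists (q%:Z - 2 * Num.floor (q%:R / 2 - k%:~R * (p%:R / 4) : R)).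
  by rewrite !mxE /= /frac intrB intrM -!pmulrn; lra.
Qed.

(** The floor in [dual_point] only adds an integer multiple of 2 pi; separating p from q in the rest
    lets the sum over Omega factor. *)
Lemma expi_dual_point k (pq : 'I_4 * 'I_2) (z : 'cV[int]_2) :
  expi (2 * pi * dot z (dual_point k pq)) =
  expi (2 * pi * (pq.1%:R * ((z 0 0 - k * z 1 0)%:~R / 4%:R))) *
  expi (2 * pi * (pq.2%:R * ((z 1 0)%:~R / 2%:R))).
Proof.
rewrite -expiD dotE !mxE /= /frac; set f := Num.floor _.
rewrite -[LHS]mulr1 -(expi2pi_int R (z 1 0 * f)) -expiD; congr expi.
by rewrite !intrM intrB intrM; lra.
Qed.

(** Orthogonality for Z^2 / S A_4 Z^2: a product of root-of-unity sums of lengths 4 and 2, testing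
    the two divisibilities of [shear_A4_rangeP]. [W] may exceed [Omega S], so that one list serves
    all shears. *)
Lemma sum_Omega (S : 'M[int]_2) (W : seq 'cV[R]_2) (z : 'cV[int]_2) :
  shear S -> uniq W -> Omega S `<=` [set` W] ->
  \sum_(w <- W | w \in Omega S) expi (2 * pi * dot z w) =
    if z \in range (mulmx (S *m A4)) then 8 else 0 :> R[i].
Proof.
move=> [k ->] uW sW; rewrite -big_filter.
rewrite (perm_big (map (dual_point k) (enum {: 'I_4 * 'I_2}))); last first.
  apply: uniq_perm; rewrite ?filter_uniq ?(map_inj_uniq (@dual_point_inj k)) ?enum_uniq //.
  move=> w; rewrite mem_filter; apply/andP/mapP => [[/set_mem]|[pq _ ->]].
    by rewrite Omega_dual_point => -[pq _ <-] _; exists pq; rewrite ?mem_enum.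
  have wO : Omega (mx2 1 k 0 1) (dual_point k pq) by rewrite Omega_dual_point; exists pq.
  by split; [exact/mem_set|exact: sW].
rewrite big_map big_enum /=.
under eq_bigr do rewrite expi_dual_point.
rewrite -(pair_big xpredT xpredT (fun (p : 'I_4) (q : 'I_2) =>
  expi (2 * pi * (p%:R * ((z 0 0 - k * z 1 0)%:~R / 4%:R))) *
  expi (2 * pi * (q%:R * ((z 1 0)%:~R / 2%:R))) : R[i])) /=.
under eq_bigr do rewrite -mulr_sumr.
rewrite -mulr_suml !sum_expi_root //.
rewrite (_ : (z \in _) = (4 %| (z 0 0 - k * z 1 0)%R)%Z && (2 %| z 1%R 0%R)%Z).
  by case: ifP; case: ifP => _ _ /=; rewrite ?mul0r ?mulr0 // -natrM.
by apply/idP/idP => [/set_mem/shear_A4_rangeP|/shear_A4_rangeP/mem_set].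
Qed.

End Lattice.

(** * Both conditions as finite trigonometric sums *)

(** [A] contains the support of [F], so the convention for infinite supports never intervenes. *)
Lemma fsum_inj_seq (V : nmodType) (I T : choiceType) (h : I -> T) (A : seq T)
    (F : T -> V) : injective h -> uniq A -> (forall k, k \notin A -> F k = 0) ->
  \sum_(i \in [set: I]) F (h i) = \sum_(k <- A | k \in range h) F k.
Proof.
move=> hI uA F0; rewrite -fsbig_image; last by move=> ? ? _ _; exact: hI.
rewrite (fsbigE [seq k <- A | k \in range h]) ?filter_uniq //.
- by rewrite big_filter_cond; apply: eq_bigl => k; rewrite andbb.
- by move=> k /=; rewrite mem_filter => /andP[/set_mem].
- by move=> k hk; rewrite mem_filter mem_set //=; exact: F0.
Qed.

Lemma fsum_bij_seq (V : nmodType) (I T : choiceType) (h : I -> T) (A : seq T)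
    (F : T -> V) : bijective h -> uniq A -> (forall k, k \notin A -> F k = 0) ->
  \sum_(i \in [set: I]) F (h i) = \sum_(k <- A) F k.
Proof.
move=> [g hK gK] uA F0; rewrite (fsum_inj_seq (can_inj hK) uA F0).
by apply: eq_bigl => k; rewrite mem_set //; exists (g k).
Qed.

(** The adjugate stands in for the inverse, which need not exist over [K]. *)
Lemma mulmx_col_inj (K : idomainType) (n : nat) (M : 'M[K]_n) :
  \det M != 0 -> injective (mulmx M : 'cV[K]_n -> 'cV[K]_n).
Proof.
move=> dM x y /(congr1 (mulmx (\adj M))); rewrite !mulmxA mul_adj_mx !mul_scalar_mx.
move=> /matrixP e; apply/matrixP => i j; have := e i j; rewrite !mxE.
exact: mulfI.
Qed.

Lemma det_mx2 a b c d : \det (mx2 a b c d) = a * d - b * c.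
Proof.
rewrite (expand_det_row _ 0) !big_ord_recl big_ord0 /cofactor !det_mx11 !mxE /=.
by rewrite addr0 expr0 expr1 mul1r mulN1r mulrN.
Qed.

Lemma det_shear_A4 S : shear S -> \det (S *m A4) = 8.
Proof. by case=> k ->; rewrite det_mulmx !det_mx2; lia. Qed.

Section Framelets.
Variables (R : realType) (r : nat) (S : 'I_r -> 'M[int]_2).
Variable (a : 'I_r -> 'cV[int]_2 -> R).
Hypothesis hS : forall l, shear (S l).
(** One list [A] for all masks and one list [W] for all [Omega (S l)] allow the sum over [l] to be
    exchanged with the others. *)
Variable A : seq 'cV[int]_2.
Hypothesis uA : uniq A.
Hypothesis aA : forall l k, k \notin A -> a l k = 0.
Variable W : seq 'cV[R]_2.
Hypothesis uW : uniq W.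
Hypothesis OW : forall l, Omega (S l) `<=` [set` W].

Lemma mask_hat_seq l xi :
  mask_hat (a l) xi = \sum_(k <- A) (a l k)%:C * expi (- dot k xi).
Proof.
apply: (fsum_bij_seq (h := id)) => // [|k /aA ->]; first by exists id.
by rewrite mul0r.
Qed.

Lemma transition_seq l M v n :
  transition (a l) M v n = \sum_(p <- A) v (p + M *m n) * (a l p)%:C.
Proof.
pose F p := v (p + M *m n) * (a l p)%:C.
rewrite /transition (eq_fsbigr (fun k => F (k - M *m n))); last first.
  by move=> k _; rewrite /F subrK conjc_real.
rewrite (fsum_bij_seq (F := F) _ uA) //.
- by exists (fun k => k + M *m n) => k; rewrite ?subrK ?addrK.
- by move=> k /aA kA; rewrite /F kA mulr0.
Qed.

(** With q = n - M k, the argument p + M k becomes n + (p - q). The constraint q - n in M Z^2 is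
    expressed by [sum_Omega], whose value 8 is exactly the factor |det M|. *)
Lemma subdivision_transition_seq l v n :
  subdivision (a l) (S l *m A4) (transition (a l) (S l *m A4) v) n =
  \sum_(q <- A) \sum_(w <- W | w \in Omega (S l)) expi (2 * pi * dot (q - n) w) *
    \sum_(p <- A) v (n + (p - q)) * (a l p)%:C * (a l q)%:C.
Proof.
set M := S l *m A4; have dM : \det M = 8 by exact/det_shear_A4/hS.
pose F q := (\sum_(p <- A) v (n + (p - q)) * (a l p)%:C) * (a l q)%:C.
rewrite /subdivision dM.
rewrite (eq_fsbigr (fun k => F (n - M *m k))); last first.
  move=> k _; rewrite transition_seq; congr (_ * _); apply: eq_bigr => p _.
  by rewrite opprB [in RHS]addrCA [n + _]addrC subrK.
rewrite (fsum_inj_seq _ uA).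
- rewrite mulr_sumr big_mkcond; apply: eq_bigr => q _.
  rewrite -!mulr_suml sum_Omega //.
  rewrite (_ : (q \in _) = (q - n \in range (mulmx M))).
    by case: ifP => _; rewrite ?mul0r.
  apply/idP/idP => /set_mem[y _ e]; apply/mem_set; exists (- y) => //.
    by rewrite mulmxN -e addrAC subrr sub0r.
  by rewrite mulmxN opprK e addrC subrK.
- move=> x y /addrI/oppr_inj; apply: mulmx_col_inj.
  by rewrite dM.
- by move=> q /aA; rewrite /F => ->; rewrite mulr0.
Qed.

(** The coefficient c_w(p, q). Its exponential comes from e^(2 pi i (q - n).w) in (i) and from the
    frequency shift 2 pi w in (ii). *)
Definition correlation (w : 'cV[R]_2) (pq : 'cV[int]_2 * 'cV[int]_2) : R[i] :=
  expi (2 * pi * dot pq.2 w) *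
  \sum_(l < r | w \in Omega (S l)) (a l pq.1)%:C * (a l pq.2)%:C.

Let AA := [seq (p, q) | p <- A, q <- A].

Lemma framelet_sum v n :
  \sum_(l < r) subdivision (a l) (S l *m A4) (transition (a l) (S l *m A4) v) n =
  \sum_(w <- W) point_char w n *
    \sum_(pq <- AA) correlation w pq * v (n + (pq.1 - pq.2)).
Proof.
under eq_bigr do rewrite subdivision_transition_seq exchange_big /= big_mkcond /=.
rewrite exchange_big; apply: eq_bigr => w _ /=.
rewrite -big_mkcond exchange_big big_allpairs [in RHS]exchange_big mulr_sumr /=.
apply: eq_bigr => q _ /=; rewrite [RHS]mulr_sumr.
under eq_bigr do rewrite [expi _ * _]mulr_sumr.
rewrite exchange_big; apply: eq_bigr => p _ /=.
rewrite /correlation /point_char /= (mulrAC _ _ (v _)) [RHS]mulrA [RHS]mulr_sumr.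
apply: eq_bigr => l _; rewrite dotDl dotNl mulrDr mulrN expiD; ring.
Qed.

(** Conjugation turns e^(-i q.(xi + 2 pi w)) into e^(i q.xi) e^(2 pi i q.w), which yields the same
    coefficients as in [framelet_sum]. *)
Lemma mask_hat_sum w xi :
  \sum_(l < r | w \in Omega (S l))
     mask_hat (a l) xi * conjc (mask_hat (a l) (xi + (2 * pi) *: w)) =
  \sum_(pq <- AA) correlation w pq * freq_char (pq.1 - pq.2) xi.
Proof.
rewrite big_allpairs.
have expand l : mask_hat (a l) xi * conjc (mask_hat (a l) (xi + (2 * pi) *: w)) =
    \sum_(p <- A) \sum_(q <- A) (a l p)%:C * expi (- dot p xi) *
      ((a l q)%:C * expi (dot q (xi + (2 * pi) *: w))).
  rewrite !mask_hat_seq rmorph_sum mulr_suml; apply: eq_bigr => p _.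
  rewrite mulr_sumr; apply: eq_bigr => q _.
  have conjcM (x y : R[i]) : conjc (x * y) = conjc x * conjc y by exact: rmorphM.
  by rewrite -[X in _ * X = _]/(conjc _) conjcM conjc_real conjc_expi opprK.
rewrite (eq_bigr _ (fun l _ => expand l)) exchange_big; apply: eq_bigr => p _ /=.
rewrite exchange_big; apply: eq_bigr => q _ /=.
rewrite /correlation /freq_char /= mulrAC mulr_sumr; apply: eq_bigr => l _.
rewrite dotDr dotZr dotDl dotNl opprD opprK.
by rewrite !expiD; ring.
Qed.

End Framelets.

(** * Character laws and the equivalence of (i) and (ii) *)

Lemma point_charD (R : realType) (w : 'cV[R]_2) m n :
  point_char w (m + n) = point_char w m * point_char w n.
Proof. by rewrite /point_char dotDl mulrDr opprD expiD. Qed.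

Lemma point_char0r (R : realType) (w : 'cV[R]_2) : point_char w 0 = 1.
Proof. by rewrite /point_char dot0l mulr0 oppr0 expi0. Qed.

Lemma point_char0l (R : realType) n : point_char (0 : 'cV[R]_2) n = 1.
Proof. by rewrite /point_char dot0r mulr0 oppr0 expi0. Qed.

Lemma freq_charD (R : realType) d (x y : 'cV[R]_2) :
  freq_char d (x + y) = freq_char d x * freq_char d y.
Proof. by rewrite /freq_char dotDr opprD expiD. Qed.

Lemma freq_char0 (R : realType) d : freq_char d (0 : 'cV[R]_2) = 1.
Proof. by rewrite /freq_char dot0r oppr0 expi0. Qed.

Lemma freq_charDl (R : realType) d e (x : 'cV[R]_2) :
  freq_char (d + e) x = freq_char d x * freq_char e x.
Proof. by rewrite /freq_char dotDl opprD expiD. Qed.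

Lemma freq_char0l (R : realType) (x : 'cV[R]_2) : freq_char 0 x = 1.
Proof. by rewrite /freq_char dot0l oppr0 expi0. Qed.

Lemma Omega0 (R : realType) S : shear S -> Omega S (0 : 'cV[R]_2).
Proof.
case=> k ->; apply/OmegaP; split=> [i||]; first by rewrite mxE lexx ltr01.
  by exists 0; rewrite mxE mul0r.
by exists 0; rewrite !mxE mulr0 addr0 mul0r.
Qed.

Lemma finite_Omega (R : realType) S : shear S -> finite_set (@Omega R S).
Proof. by case=> k ->; rewrite Omega_dual_point; exact: finite_image. Qed.

Lemma sum_delta (R : realType) (W : seq 'cV[R]_2) (F : 'cV[R]_2 -> R[i]) :
  uniq W -> 0 \in W -> \sum_(w <- W) F w * delta w = F 0.
Proof.
move=> uW W0; rewrite (bigD1_seq 0) //= /delta eqxx mulr1 big1 ?addr0 //.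
by move=> w /negPf ->; rewrite mulr0.
Qed.

Theorem theorem1p1 (R : realType) (r : nat) (hr : (1 <= r)%N)
    (S : 'I_r -> 'M[int]_2) (hS : forall l, shear (S l))
    (a : 'I_r -> 'cV[int]_2 -> R) (ha : forall l, finitely_supported (a l)) :
  (forall (v : 'cV[int]_2 -> R[i]) (n : 'cV[int]_2),
      \sum_(l < r)
        subdivision (a l) (S l *m A4) (transition (a l) (S l *m A4) v) n = v n)
  <->
  (forall w : 'cV[R]_2, (\bigcup_(l in [set: 'I_r]) Omega (S l)) w ->
   forall xi : 'cV[R]_2,
      \sum_(l < r | w \in Omega (S l))
        mask_hat (a l) xi * conjc (mask_hat (a l) (xi + (2 * pi) *: w))
      = delta w).
Proof.
have /finite_seqP[A0 A0E] : finite_set (\bigcup_l [set k | a l k != 0]).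
  by apply: bigcup_finite => // l _; exact: ha.
have /finite_seqP[W0 W0E] : finite_set (\bigcup_l @Omega R (S l)).
  by apply: bigcup_finite => // l _; exact: finite_Omega.
set A := undup A0; set W := undup W0.
have uA : uniq A by exact: undup_uniq.
have uW : uniq W by exact: undup_uniq.
have aA l k : k \notin A -> a l k = 0.
  rewrite mem_undup => kA; apply/eqP; apply: contraNT kA => alk.
  have : [set` A0] k by rewrite -A0E; exists l.
  by [].
have WP w : (\bigcup_l @Omega R (S l)) w <-> w \in W.
  by rewrite W0E /= mem_undup.
have OW l : Omega (S l) `<=` [set` W] by move=> w Ow; apply/WP; exists l.
have Wsq : {in W, forall w, w \in @unit_square R}.
  by move=> w /WP[l _ [_ sq]]; exact/mem_set.
(* This uses r >= 1: for r = 0, (ii) would be vacuous while (i) would fail. *)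
have zW : 0 \in W.
  by apply/WP; exists (Ordinal hr) => //; exact: Omega0.
under eq_forall do under eq_forall do rewrite (framelet_sum hS uA aA uW OW).
under [X in _ <-> X]eq_forall do
  under eq_forall do under eq_forall do rewrite (mask_hat_sum S uA aA).
set AA := [seq _ | p <- A, q <- A].
split=> [hi w /WP wW xi|hii v n].
  set G := fun w => \sum_(pq <- AA) correlation S a w pq * freq_char (pq.1 - pq.2) xi.
  apply/eqP; rewrite -subr_eq0 -/(G w); apply/eqP.
  (* With [xi] fixed, independence is applied to characters of Z^2, the coefficients being the
     defects [G w - delta w]. *)
  apply: (characters_independent (c := fun w => G w - delta w) (@point_charD R)
    (@point_char0r R) uW) => // [w1 w2 /Wsq sq1 /Wsq sq2|m].
    exact: point_char_inj.
  have fm : freq_char m xi != 0.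
    apply/eqP => fm0; have := freq_char0l xi; rewrite -(subrr m) freq_charDl fm0 mul0r.
    by move/esym/eqP; rewrite oner_eq0.
  (* For this [v], v(m + d) = v(m) e^(-i d.xi), so v(m) factors out of (i) and cancels. *)
  have := hi (fun k => freq_char k xi) m.
  rewrite (eq_bigr (fun w => freq_char m xi * (point_char w m * G w))); last first.
    move=> w' _; rewrite mulrCA; congr (_ * _); rewrite mulr_sumr.
    by apply: eq_bigr => pq _; rewrite freq_charDl mulrCA.
  rewrite -mulr_sumr -[RHS]mulr1 => /(mulfI fm) h1.
  under eq_bigr do rewrite mulrC mulrBr.
  by rewrite sumrB h1 sum_delta // point_char0l subrr.
(* In G_w(xi) = delta(w), valid for all [xi], each e^(-i d.xi) may be replaced by v(n + d); the
   constant belongs to d = 0 and receives v(n). *)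
have key w : w \in W ->
    \sum_(pq <- AA) correlation S a w pq * v (n + (pq.1 - pq.2)) = v n * delta w.
  move=> wW.
  (* The extra index None, with d None = 0, carries the constant delta w. *)
  pose c o := if o is Some pq then correlation S a w pq else - delta w.
  pose d (o : option ('cV[int]_2 * 'cV[int]_2)) :=
    if o is Some pq then pq.1 - pq.2 else 0.
  have := @character_sum_eq0 _ _ _ (@freq_char R) _ (None :: map Some AA) d c
    (@freq_charD R) (@freq_char0 R) (@freq_char_inj R) _ (fun e => v (n + e)).
  rewrite big_cons big_map /= addr0 addrC => /(_ _)/eqP.
  rewrite mulNr subr_eq0 mulrC => h; apply/eqP; apply: h => xi.
  rewrite big_cons big_map /= freq_char0l mulr1 hii; last exact/WP.
  by rewrite addNr.
rewrite (eq_big_seq (fun w => point_char w n * v n * delta w)) => [|w wW].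
  by rewrite sum_delta // point_char0l mul1r.
by rewrite key // mulrA.
Qed.
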